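(* Let $\lambda\in\mathbb{R}$ and let $p$ be a positive integer. Then for all real $x$, \[ \sum_{n=1}^{\infty}\Big((1)_{p,\lambda}+(2)_{p,\lambda}+\cdots+(n)_{p,\lambda}\Big)\frac{x^n}{n!}=e^{x}\phi_{p,\lambda}(x)+e^{x}\int_0^x\phi_{p,\lambda}(t)\,dt. \]
   Context: For $\lambda\in\mathbb{R}$, the generalized falling factorials are $(x)_{0,\lambda}=1$ and $(x)_{n,\lambda}=x(x-\lambda)(x-2\lambda)\cdots(x-(n-1)\lambda)$ for $n\ge 1$. The degenerate exponential is the formal power series $e_\lambda(t)=\sum_{n\ge 0}(1)_{n,\lambda}\frac{t^n}{n!}$. The degenerate Bell polynomials $\phi_{n,\lambda}(x)$ are defined by the generating function $e^{x(e_\lambda(t)-1)}=\sum_{n=0}^{\infty}\phi_{n,\lambda}(x)\frac{t^n}{n!}$ (as formal power series in $t$). *)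

(* Defs.v *)
From Stdlib Require Export Reals Factorial.
From Coquelicot Require Export Coquelicot.
From Stdlib Require Import Lia.
Local Open Scope R_scope.

Fixpoint gen_falling (lambda x : R) (n : nat) : R :=
  match n with
  | O => 1
  | S m => gen_falling lambda x m * (x - INR m * lambda)
  end.

(* Formal power series are represented, as in Coquelicot's PSeries, by their
   coefficient sequences: a : nat -> R stands for sum_n (a n) t^n, and PS_mult
   is the Cauchy product. *)

Definition PS_one (n : nat) : R :=
  match n with O => 1 | S _ => 0 end.

Fixpoint PS_pow (a : nat -> R) (k : nat) : nat -> R :=
  match k with
  | O => PS_one
  | S m => PS_mult a (PS_pow a m)
  end.

(* The formal exponential sum_k a^k / k!, meaningful when a 0 = 0: then a^k has
   no terms of degree < k (PS_pow_low below), so the coefficient of t^n in the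
   sum over all k is the sum of those for k <= n. *)
Definition PS_exp (a : nat -> R) (n : nat) : R :=
  sum_f_R0 (fun k => PS_pow a k n / INR (fact k)) n.

Lemma PS_pow_low (a : nat -> R) (k n : nat) :
  a O = 0 -> (n < k)%nat -> PS_pow a k n = 0.
Proof.
intros Ha; revert n; induction k as [|k IH]; intros n Hn; [lia|].
simpl; unfold PS_mult.
rewrite (sum_eq _ (fun _ => 0)), sum_cte; [ring|].
intros i Hi; destruct i as [|i].
- rewrite Ha; ring.
- rewrite IH; [ring|lia].
Qed.

Definition degenerate_exp (lambda : R) (n : nat) : R :=
  gen_falling lambda 1 n / INR (fact n).

Definition degenerate_Bell_gf (lambda x : R) : nat -> R :=
  PS_exp (PS_scal x (PS_minus (degenerate_exp lambda) PS_one)).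

(* The generating function is exponential, so phi_n is n! times the coefficient
   of t^n. *)
Definition degenerate_Bell (lambda : R) (n : nat) (x : R) : R :=
  INR (fact n) * degenerate_Bell_gf lambda x n.

(* Main.v *)
(** The coefficients [S p k] of [phi_(p,lambda)] are the degenerate Stirling
    numbers: expanding [e_lambda^n = (1 + (e_lambda - 1))^n] by the binomial
    theorem gives [(n)_(p,lambda) = sum_k (S p k) n(n-1)...(n-k+1)].  Summing
    over [n] telescopes, [1_k + ... + n_k = n_k + n_(k+1) / (k+1)] for the
    ordinary falling factorials [n_k] with [k >= 1], and
    [sum_n n_k x^n / n! = x^k e^x]; the two terms give [phi] and its integral. *)

Require Import Defs.
From Stdlib Require Import Reals Factorial.
From Coquelicot Require Import Coquelicot.
From Stdlib Require Import Lia Lra.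
Local Open Scope R_scope.

(** * Finite sums, and series and derivatives taken through them *)

Lemma sum_f_R0_scal_l (c : R) (f : nat -> R) (n : nat) :
  sum_f_R0 (fun k => c * f k) n = c * sum_f_R0 f n.
Proof.
rewrite scal_sum; apply sum_eq; intros; ring.
Qed.

Lemma sum_f_R0_swap (f : nat -> nat -> R) (m n : nat) :
  sum_f_R0 (fun i => sum_f_R0 (f i) n) m
  = sum_f_R0 (fun j => sum_f_R0 (fun i => f i j) m) n.
Proof.
induction m as [|m IH]; simpl; [reflexivity|].
now rewrite IH, <- sum_plus.
Qed.

Lemma is_series_sum_f_R0 (f : nat -> nat -> R) (l : nat -> R) (n : nat) :
  (forall k, is_series (f k) (l k)) ->
  is_series (fun m => sum_f_R0 (fun k => f k m) n) (sum_f_R0 l n).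
Proof.
intros H; induction n as [|n IH]; simpl; [apply H|].
exact (is_series_plus _ _ _ _ IH (H (S n))).
Qed.

Lemma is_derive_sum_f_R0 (f : nat -> R -> R) (df : nat -> R) (n : nat) (x : R) :
  (forall k, is_derive (f k) x (df k)) ->
  is_derive (fun t => sum_f_R0 (fun k => f k t) n) x (sum_f_R0 df n).
Proof.
intros H; induction n as [|n IH]; simpl; [apply H|].
exact (is_derive_plus _ _ x _ _ IH (H (S n))).
Qed.

(** * Falling factorials, ordinary and degenerate *)

Lemma gen_falling_0_S (lambda : R) (n : nat) : gen_falling lambda 0 (S n) = 0.
Proof.
induction n as [|n IH]; [simpl; ring|].
change (gen_falling lambda 0 (S n) * (0 - INR (S n) * lambda) = 0).
rewrite IH; ring.
Qed.

Lemma falling_succ_head (x : R) (k : nat) :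
  gen_falling 1 (x + 1) (S k) = (x + 1) * gen_falling 1 x k.
Proof.
induction k as [|k IH]; [simpl; ring|].
change (gen_falling 1 (x + 1) (S k) * (x + 1 - INR (S k) * 1)
        = (x + 1) * (gen_falling 1 x k * (x - INR k * 1))).
rewrite IH, S_INR; ring.
Qed.

(** All terms share the k-th falling factorial of [x]; the remaining factors satisfy x + 1 = (x - k)
    + (k + 1). *)
Lemma falling_pascal (x : R) (k : nat) :
  gen_falling 1 (x + 1) (S k)
  = gen_falling 1 x (S k) + INR (S k) * gen_falling 1 x k.
Proof.
rewrite falling_succ_head, S_INR; simpl; ring.
Qed.

(** Telescoping of [falling_pascal]. Starting at i = 0 includes the term 1 when k = 0, so that the
    formula needs no exception there. *)
Lemma sum_falling (k n : nat) :
  sum_f_R0 (fun i => gen_falling 1 (INR i) k) n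
  = gen_falling 1 (INR n + 1) (S k) / INR (S k).
Proof.
assert (Hk : INR (S k) <> 0) by (apply not_0_INR; lia).
induction n as [|n IH].
- simpl sum_f_R0; change (INR 0) with 0.
  rewrite falling_pascal, gen_falling_0_S; now field.
- rewrite tech5, IH, (S_INR n), (falling_pascal (INR n + 1)); now field.
Qed.

(** The coefficient of t^n in the formal power e_lambda(t)^x; for lambda = 1 it is the binomial
    coefficient of [x] over [n]. *)
Definition falling_coef (lambda x : R) (n : nat) : R :=
  gen_falling lambda x n / INR (fact n).

(** Coefficientwise form of the differential equation (1 + lambda t) f' = x f for f = e_lambda^x. *)
Lemma falling_coef_S (lambda x : R) (n : nat) :
  INR (S n) * falling_coef lambda x (S n)
  = (x - INR n * lambda) * falling_coef lambda x n.
Proof.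
unfold falling_coef; rewrite fact_simpl, mult_INR; simpl gen_falling.
field; split; [apply INR_fact_neq_0 | apply not_0_INR; lia].
Qed.

(** This is e_lambda^x e_lambda^y = e_lambda^(x+y): both sides obey the recurrence [falling_coef_S]
    for x + y. *)
Lemma falling_coef_vandermonde (lambda x y : R) (n : nat) :
  PS_mult (falling_coef lambda x) (falling_coef lambda y) n
  = falling_coef lambda (x + y) n.
Proof.
unfold PS_mult; induction n as [|n IH].
- unfold falling_coef; simpl; field.
- apply (Rmult_eq_reg_l (INR (S n))); [|apply not_0_INR; lia].
  rewrite falling_coef_S, <- IH, <- !sum_f_R0_scal_l.
  (* As for a derivation, the weight [n + 1] is split as [i + (n + 1 - i)]. *)
  rewrite (sum_eq _ (fun i =>
      INR i * falling_coef lambda x i * falling_coef lambda y (S n - i)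
      + falling_coef lambda x i
        * (INR (S n - i) * falling_coef lambda y (S n - i)))).
  2: { intros i Hi; rewrite (minus_INR (S n) i) by lia; ring. }
  (* The weights kill the term i = 0 of the first sum and i = n + 1 of the second. After a shift of
     the first, the weights add up to (x - i lambda) + (y - (n - i) lambda) = x + y - n lambda. *)
  rewrite sum_plus, decomp_sum, (tech5 _ n) by lia.
  simpl pred; rewrite Nat.sub_diag; change (INR 0) with 0.
  rewrite !Rmult_0_l, Rmult_0_r, Rplus_0_l, Rplus_0_r, <- sum_plus.
  apply sum_eq; intros i Hi.
  rewrite falling_coef_S, (Nat.sub_succ_l i n), falling_coef_S by lia.
  rewrite minus_INR by lia.
  change (S n - S i)%nat with (n - i)%nat; ring.
Qed.

Lemma PS_pow_degenerate_exp (lambda : R) (n m : nat) :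
  PS_pow (degenerate_exp lambda) n m = falling_coef lambda (INR n) m.
Proof.
revert m; induction n as [|n IH]; intros m.
- unfold falling_coef; destruct m as [|m]; [simpl; field|].
  change (INR 0) with 0; rewrite gen_falling_0_S; simpl PS_pow.
  unfold Rdiv; ring.
- rewrite S_INR, Rplus_comm, <- falling_coef_vandermonde.
  simpl PS_pow; apply sum_eq; intros i _; now rewrite IH.
Qed.

(** * Binomial expansion of formal powers *)

Lemma PS_pow_scal (c : R) (a : nat -> R) (k m : nat) :
  PS_pow (PS_scal c a) k m = c ^ k * PS_pow a k m.
Proof.
revert m; induction k as [|k IH]; intros m; simpl; [ring|].
unfold PS_mult; rewrite <- sum_f_R0_scal_l.
apply sum_eq; intros i _; rewrite IH.
change (PS_scal c a i) with (c * a i); ring.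
Qed.

Lemma PS_mult_one_l (b : nat -> R) (m : nat) : PS_mult PS_one b m = b m.
Proof.
unfold PS_mult; destruct m as [|m]; [simpl; ring|].
rewrite decomp_sum by lia; simpl.
rewrite (sum_eq _ (fun _ => 0)) by (intros; ring).
rewrite sum_cte; ring.
Qed.

(* The sum may be cut at any [K >= m] instead of [n]: for [k > n] the falling
   factorial vanishes, and for [k > m] the coefficient of degree [m] of
   [(a - 1)^k] does. *)
Lemma PS_pow_binomial (a : nat -> R) (n m K : nat) :
  a O = 1 -> (m <= K)%nat ->
  PS_pow a n m
  = sum_f_R0 (fun k => falling_coef 1 (INR n) k
                       * PS_pow (PS_minus a PS_one) k m) K.
Proof.
intros Ha; set (b := PS_minus a PS_one).
assert (Hb : forall i, a i = PS_one i + b i).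
{ intros i; unfold b; change (a i = PS_one i + (a i + - PS_one i)); ring. }
assert (Hb0 : b O = 0).
{ generalize (Hb O); rewrite Ha; simpl; lra. }
revert m; induction n as [|n IH]; intros m Hm.
- change (INR 0) with 0.
  assert (H0 : falling_coef 1 0 0 = 1) by (unfold falling_coef; simpl; field).
  destruct K as [|K]; [simpl sum_f_R0; rewrite H0; simpl; ring|].
  rewrite decomp_sum, H0 by lia.
  rewrite (sum_eq _ (fun _ => 0)), sum_cte; [simpl; ring|].
  intros i _; unfold falling_coef.
  rewrite gen_falling_0_S; unfold Rdiv; ring.
(* This is a^(n+1) = a^n + b a^n. The product b a^n uses the induction hypothesis in every degree m
   - i <= K, hence a cut [K] that does not depend on [m]. *)
- assert (Hrec : PS_pow a (S n) m
      = sum_f_R0 (fun k => falling_coef 1 (INR n) k * PS_pow b k m) K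
        + sum_f_R0 (fun k => falling_coef 1 (INR n) k * PS_pow b (S k) m) K).
  { rewrite <- IH by assumption.
    rewrite <- (PS_mult_one_l (PS_pow a n)); simpl PS_pow.
    rewrite (sum_eq (fun k => falling_coef 1 (INR n) k * _)
      (fun k => sum_f_R0 (fun i =>
         b i * (falling_coef 1 (INR n) k * PS_pow b k (m - i))) m)).
    2: { intros k _; unfold PS_mult; rewrite <- sum_f_R0_scal_l.
         apply sum_eq; intros; ring. }
    rewrite sum_f_R0_swap; unfold PS_mult; rewrite <- sum_plus.
    apply sum_eq; intros i Hi.
    rewrite sum_f_R0_scal_l, <- IH, Hb by lia; ring. }
  rewrite Hrec; clear Hrec IH.
  assert (Hp : forall k, falling_coef 1 (INR (S n)) (S k)
      = falling_coef 1 (INR n) (S k) + falling_coef 1 (INR n) k).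
  { intros k; unfold falling_coef; rewrite S_INR, falling_pascal.
    rewrite fact_simpl, mult_INR; field.
    split; [apply INR_fact_neq_0 | apply not_0_INR; lia]. }
  destruct K as [|K].
  + cbn [sum_f_R0]; rewrite (PS_pow_low b 1 m Hb0) by lia.
    unfold falling_coef; simpl; ring.
  + rewrite (tech5 (fun k => _ * PS_pow b (S k) m)).
    (* The last term of the shifted sum has power K + 2 > m; without it, the two sums combine by
       Pascal's rule [Hp]. *)
    rewrite (PS_pow_low b (S (S K)) m Hb0) by lia.
    rewrite !(decomp_sum (fun k => _ * PS_pow b k m)) by lia.
    rewrite Rmult_0_r, Rplus_0_r, Rplus_assoc, <- sum_plus.
    f_equal.
    apply sum_eq; intros k _; rewrite Hp; ring.
Qed.

(** * Degenerate Stirling numbers *)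

Definition degenerate_Stirling (lambda : R) (p k : nat) : R :=
  INR (fact p) / INR (fact k)
  * PS_pow (PS_minus (degenerate_exp lambda) PS_one) k p.

Lemma degenerate_Bell_Stirling (lambda : R) (p : nat) (x : R) :
  degenerate_Bell lambda p x
  = sum_f_R0 (fun k => degenerate_Stirling lambda p k * x ^ k) p.
Proof.
unfold degenerate_Bell, degenerate_Bell_gf, PS_exp.
rewrite <- sum_f_R0_scal_l; apply sum_eq; intros k _.
rewrite PS_pow_scal; unfold degenerate_Stirling.
field; apply INR_fact_neq_0.
Qed.

(** The coefficient of t^p in e_lambda^n is computed twice: directly, and from the binomial
    expansion cut at k = p. *)
Lemma gen_falling_Stirling (lambda : R) (p n : nat) :
  gen_falling lambda (INR n) p
  = sum_f_R0 (fun k => degenerate_Stirling lambda p k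
                       * gen_falling 1 (INR n) k) p.
Proof.
assert (H : falling_coef lambda (INR n) p = PS_pow (degenerate_exp lambda) n p)
  by (symmetry; apply PS_pow_degenerate_exp).
rewrite (PS_pow_binomial _ n p p) in H;
  [|unfold degenerate_exp; simpl; field|lia].
replace (gen_falling lambda (INR n) p)
  with (INR (fact p) * falling_coef lambda (INR n) p)
  by (unfold falling_coef; field; apply INR_fact_neq_0).
rewrite H, <- sum_f_R0_scal_l; apply sum_eq; intros k _.
unfold falling_coef, degenerate_Stirling; field; apply INR_fact_neq_0.
Qed.

Lemma sum_gen_falling_Stirling (lambda : R) (p n : nat) :
  sum_f_R0 (fun i => gen_falling lambda (INR i) p) n
  = sum_f_R0 (fun k => degenerate_Stirling lambda p k
      * (gen_falling 1 (INR n) k + gen_falling 1 (INR n) (S k) / INR (S k))) p.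
Proof.
rewrite (sum_eq _ _ _ (fun i _ => gen_falling_Stirling lambda p i)).
rewrite sum_f_R0_swap; apply sum_eq; intros k _.
(* The closed form is split by Pascal's rule into the part that yields phi and the part that yields
   its integral. *)
rewrite sum_f_R0_scal_l, sum_falling, falling_pascal.
field; apply not_0_INR; lia.
Qed.

(** * Exponential series and the integral of phi *)

Lemma is_series_falling_exp (k : nat) (x : R) :
  is_series (fun n => gen_falling 1 (INR n) k * (x ^ n / INR (fact n)))
    (x ^ k * exp x).
Proof.
induction k as [|k IH].
- apply (is_series_ext (fun n => / INR (fact n) * x ^ n)).
  { intros n; change (/ INR (fact n) * x ^ n = 1 * (x ^ n / INR (fact n))).
    unfold Rdiv; ring. }
  simpl pow; rewrite Rmult_1_l.
  apply is_series_Reals; unfold infinite_sum.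
  exact (proj2_sig (exist_exp x)).
(* The term n = 0 vanishes; in the term n + 1 the head factor n + 1 of the falling factorial cancels
   against (n + 1)!, leaving x times the n-th term for [k]. *)
- apply (is_series_decr_1 (V := R_NormedModule)).
  change (INR 0) with 0; rewrite gen_falling_0_S.
  apply (is_series_ext
    (fun n => scal x (gen_falling 1 (INR n) k * (x ^ n / INR (fact n))))).
  { intros n; rewrite S_INR, falling_succ_head, fact_simpl, mult_INR, S_INR.
    change (x * (gen_falling 1 (INR n) k * (x ^ n / INR (fact n)))
      = (INR n + 1) * gen_falling 1 (INR n) k
        * (x ^ S n / ((INR n + 1) * INR (fact n)))).
    simpl pow; field; split; [apply INR_fact_neq_0|].
    rewrite <- S_INR; apply not_0_INR; lia. }
  replace (plus _ _) with (scal x (x ^ k * exp x)).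
  + now apply (is_series_scal (V := R_NormedModule)).
  + unfold plus, opp, scal, mult; simpl; unfold mult; simpl; ring.
Qed.

Lemma is_RInt_degenerate_Bell (lambda : R) (p : nat) (x : R) :
  is_RInt (fun t => degenerate_Bell lambda p t) 0 x
    (sum_f_R0 (fun k => degenerate_Stirling lambda p k
                        * (x ^ S k / INR (S k))) p).
Proof.
set (G := fun t => sum_f_R0 (fun k => degenerate_Stirling lambda p k
                        * (t ^ S k / INR (S k))) p).
assert (HG0 : G 0 = 0).
{ unfold G; rewrite (sum_eq _ (fun _ => 0)), sum_cte; [ring|].
  intros k _; simpl pow; unfold Rdiv; ring. }
replace (sum_f_R0 _ p) with (minus (G x) (G 0))
  by (rewrite HG0; unfold minus, plus, opp, G; simpl; ring).
apply (is_RInt_ext (fun t =>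
  sum_f_R0 (fun k => degenerate_Stirling lambda p k * t ^ k) p)).
{ intros t _; now rewrite degenerate_Bell_Stirling. }
apply (is_RInt_derive (V := R_CompleteNormedModule)); intros t _.
- unfold G; apply is_derive_sum_f_R0; intros k.
  assert (Hk : INR (S k) <> 0) by (apply not_0_INR; lia).
  auto_derive; [trivial|].
  (* The [match] is the unfolded form of [INR (S k)]. *)
  change (match k with O => 1 | S _ => INR k + 1 end) with (INR (S k)) in *.
  field; assumption.
- apply (ex_derive_continuous (V := R_NormedModule)).
  eexists; apply (is_derive_sum_f_R0
    (fun k t => degenerate_Stirling lambda p k * t ^ k)
    (fun k => degenerate_Stirling lambda p k * (INR k * t ^ pred k))).
  intros k; auto_derive; [trivial | ring].
Qed.

Theorem theorem4 (lambda : R) (p : nat) (hp : (1 <= p)%nat) (x : R) :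
  is_series
    (fun m : nat =>
       let n := S m in
       sum_n_m (fun k : nat => gen_falling lambda (INR k) p) 1 n
         * (x ^ n / INR (fact n)))
    (exp x * degenerate_Bell lambda p x
     + exp x * RInt (fun t : R => degenerate_Bell lambda p t) 0 x).
Proof.
rewrite (is_RInt_unique _ _ _ _ (is_RInt_degenerate_Bell lambda p x)).
rewrite degenerate_Bell_Stirling, <- Rmult_plus_distr_l, <- sum_plus.
rewrite <- sum_f_R0_scal_l.
(* Here p >= 1 matters: the vanishing value at 0 lets both the inner sums and the outer series start
   at 0. *)
assert (H0 : gen_falling lambda (INR 0) p = 0).
{ destruct p as [|p]; [lia|]; apply gen_falling_0_S. }
set (u := fun n => sum_f_R0 (fun i => gen_falling lambda (INR i) p) n
                   * (x ^ n / INR (fact n))).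
assert (Hu : is_series u (sum_f_R0 (fun k =>
  exp x * (degenerate_Stirling lambda p k * x ^ k
           + degenerate_Stirling lambda p k * (x ^ S k / INR (S k)))) p)).
{ apply (is_series_ext (fun n => sum_f_R0 (fun k =>
    degenerate_Stirling lambda p k
    * (gen_falling 1 (INR n) k * (x ^ n / INR (fact n))
       + / INR (S k) * (gen_falling 1 (INR n) (S k) * (x ^ n / INR (fact n))))) p)).
  { intros n; unfold u; rewrite sum_gen_falling_Stirling, Rmult_comm.
    rewrite <- sum_f_R0_scal_l; apply sum_eq; intros k _; unfold Rdiv; ring. }
  apply is_series_sum_f_R0; intros k.
  replace (exp x * _) with (degenerate_Stirling lambda p k
    * (x ^ k * exp x + / INR (S k) * (x ^ S k * exp x))) by (unfold Rdiv; ring).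
  apply (is_series_scal (V := R_NormedModule)).
  apply (is_series_plus (V := R_NormedModule)); [apply is_series_falling_exp|].
  apply (is_series_scal (V := R_NormedModule)); apply is_series_falling_exp. }
apply (is_series_ext (fun m => u (S m))).
{ intros m; unfold u; cbv zeta; f_equal.
  rewrite <- sum_n_Reals; unfold sum_n.
  rewrite sum_Sn_m by lia; rewrite H0; apply Rplus_0_l. }
apply (is_series_incr_1 (V := R_NormedModule)).
assert (Hu0 : u O = 0) by (unfold u; cbn [sum_f_R0]; rewrite H0; ring).
rewrite Hu0; eapply eq_ind; [exact Hu | symmetry; apply Rplus_0_r].
Qed.
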